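(* Let $(J_k:\mathcal H_k\to\mathcal H_\infty)_{k\in\mathbb N}$ be a sequence of contractions between Hilbert spaces, with defect operators $W_k,W_{\infty,k}$, and let $P_k$ ($k\in\mathbb N$) and $P_\infty$ be the orthogonal projections of the associated parent space. Let $n\in\mathbb N$. Then the following assertions are equivalent: (1) the identification operator $J_n$ is a partial isometry; (2) the defect operator $W_n$ is an orthogonal projection (onto $\ker J_n$); (3) $\operatorname{spec}(W_n)\subset\{0,1\}$; (4) $J_nW_n=0$; (5) the identification operator $J_n^*$ is a partial isometry; (6) the defect operator $W_{\infty,n}$ is an orthogonal projection (onto $\ker J_n^*$); (7) $\operatorname{spec}(W_{\infty,n})\subset\{0,1\}$; (8) $W_{\infty,n}J_n=0$; (9) the projections commute, i.e. $P_nP_\infty=P_\infty P_n$.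
   Context: All Hilbert spaces are complex and separable; $\mathbb N=\{1,2,\dots\}$, $\overline{\mathbb N}=\mathbb N\cup\{\infty\}$; $\operatorname{spec}$ denotes the spectrum. For contractions $J_k:\mathcal H_k\to\mathcal H_\infty$ (i.e. $\|J_k\|\le1$) the defect operators are $W_k:=(\mathrm{id}_{\mathcal H_k}-J_k^*J_k)^{1/2}$ and $W_{\infty,k}:=(\mathrm{id}_{\mathcal H_\infty}-J_kJ_k^* )^{1/2}$. The associated parent space is the Hilbert space direct sum $\mathcal H=\mathcal H_\infty\oplus\bigoplus_{k=1}^\infty\mathcal H_k$, with elements $f=(f_\infty,f_1,f_2,\dots)$, together with the associated isometries $\iota_kf_k=(J_kf_k,0,\dots,0,W_kf_k,0,\dots)$ (entry $W_kf_k$ in the $k$-th component) for $k\in\mathbb N$ and $\iota_\infty f_\infty=(f_\infty,0,0,\dots)$. The projections are $P_k=\iota_k\iota_k^*$, $k\in\overline{\mathbb N}$. A partial isometry is a bounded operator whose restriction to the orthogonal complement of its kernel is an isometry. *)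

(* Defs.v *)
From HB Require Import structures.
From mathcomp Require Import all_boot all_order all_algebra.
From mathcomp Require Import complex.
From mathcomp Require Import boolp classical_sets functions cardinality reals.
From mathcomp Require Import topology normedtype sequences.
Set Implicit Arguments.
Unset Strict Implicit.
Unset Printing Implicit Defensive.
Import Order.TTheory GRing.Theory Num.Theory.
Import numFieldNormedType.Exports.
Local Open Scope classical_set_scope.
Local Open Scope complex_scope.
Local Open Scope ring_scope.

(* The inner product is linear in its first argument and conjugate-linear in
   its second one. *)
HB.mixin Record NormedModule_isHilbert (R : realType) V
    & CompleteNormedModule R[i] V := {
  inner : {dot V for (@Num.conj R[i])};
  inner_normE : forall x : V, inner x x = `|x| ^+ 2
}.

#[short(type="hilbertType")]
HB.structure Definition Hilbert (R : realType) :=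
  {V of CompleteNormedModule R[i] V & NormedModule_isHilbert R V}.

Section DotNorm.
Variables (C : numClosedFieldType) (U : lmodType C).
Variable form : {dot U for (@Num.conj C)}.
Local Notation "''[' u , v ]" := (form u%R v%R) : ring_scope.
Local Notation "''[' u ]" := '[u, u]%R : ring_scope.

Lemma dot_CauchySchwarz u v : `|'[u, v]| ^+ 2 <= '[u] * '[v].
Proof.
have [->|nz_v] := eqVneq v 0; first by rewrite !linear0r normr0 mulr0 expr0n.
pose a := '[u, v] / '[v]; pose u1 := u - a *: v.
have v0 : '[v] != 0 by rewrite dnorm_eq0.
have ou : '[u1, v] = 0 by rewrite linearBl/= linearZl_LR/= divfK// subrr.
have -> : '[u] = '[u1] + `|a| ^+ 2 * '[v].
  rewrite -dnormZ -hnormDd; first by rewrite subrK.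
  by rewrite linearZr_LR/= ou mulr0.
rewrite mulrDl -mulrA -expr2.
have -> : `|a| ^+ 2 * '[v] ^+ 2 = `|'[u, v]| ^+ 2.
  rewrite /a normrM normfV exprMn exprVn (ger0_norm (dnorm_ge0 _ _)).
  by rewrite divfK// expf_neq0.
by rewrite lerDr mulr_ge0.
Qed.

Lemma sqrt_dnormD u v : sqrtC '[u + v] <= sqrtC '[u] + sqrtC '[v].
Proof.
rewrite -ler_sqr ?nnegrE ?addr_ge0 ?sqrt_dnorm_ge0//.
rewrite sqrrD !sqrtCK addrAC dnormD lerD2l.
rewrite -mulr_natr -[_ + _](divfK (negbT (pnatr_eq0 C 2))).
rewrite ler_pM2r ?ltr0n// -ReE.
apply: (le_trans (leif_Re_Creal '[u, v]).1).
rewrite -ler_sqr ?nnegrE ?mulr_ge0 ?sqrt_dnorm_ge0 ?normr_ge0//.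
by rewrite exprMn !sqrtCK dot_CauchySchwarz.
Qed.

Lemma sqrt_dnormZ (a : C) u : sqrtC '[a *: u] = `|a| * sqrtC '[u].
Proof. by rewrite dnormZ rootCMl ?exprn_ge0// sqrCK. Qed.

Lemma sqrt_dnorm0_eq0 u : sqrtC '[u] = 0 -> u = 0.
Proof. by move/eqP; rewrite sqrt_dnorm_eq0 => /eqP. Qed.

End DotNorm.

Section ComplexLimits.
Variable R : realType.
Implicit Types (u : nat -> R[i]^o).

Lemma cvg_realC (u : nat -> R) (l : R) : u @ \oo --> l ->
  ((fun n => (u n)%:C) : nat -> R[i]^o) @ \oo --> (l%:C : R[i]^o).
Proof.
move=> ul; apply/cvgrPdist_lt => e e0.
have eE : e = (complex.Re e)%:C by rewrite RRe_real// gtr0_real.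
have e0' : 0 < complex.Re e by rewrite -ltcR -eE.
move/cvgrPdist_lt : ul => /(_ _ e0').
apply: filterS => n; rewrite -rmorphB normc_def/= eE ltcR.
by rewrite expr0n/= addr0 sqrtr_sqr.
Qed.

Lemma cvg_complex (a b : nat -> R) : cvgn a -> cvgn b ->
  cvgn ((fun n => a n +i* b n) : nat -> R[i]^o).
Proof.
move=> /cvg_ex[/= l al] /cvg_ex[/= m bm]; apply/cvg_ex.
exists ((l%:C : R[i]^o) + ('i : R[i]) *: (m%:C : R[i]^o)).
rewrite (_ : (fun n => _) = (fun n => (a n)%:C : R[i]^o) \+
   (fun n => ('i : R[i]) *: ((b n)%:C : R[i]^o))); last first.
  by apply/funext => n /=; rewrite [LHS]complexE.
by apply: cvgD; [exact: cvg_realC|apply: cvgZr; exact: cvg_realC].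
Qed.

Lemma cvg_Re u (l : R[i]^o) : u @ \oo --> l ->
  (fun n => complex.Re (u n)) @ \oo --> complex.Re l.
Proof.
move=> ul; apply/cvgrPdist_lt => e e0.
have e0' : 0 < (e%:C : R[i]) by rewrite ltcR.
move/cvgrPdist_lt : ul => /(_ _ e0').
apply: filterS => n; rewrite -(raddfB (@complex.Re R : Rcomplex R -> R)) -ltcR.
by move=> h; apply: le_lt_trans h; exact: normc_ge_Re.
Qed.

Lemma cvg_conj u (l : R[i]^o) : u @ \oo --> l ->
  ((fun n => Num.conj (u n : R[i])) : nat -> R[i]^o) @ \oo -->
  (Num.conj (l : R[i]) : R[i]^o).
Proof.
move=> ul; apply/cvgrPdist_lt => e e0.
move/cvgrPdist_lt : ul => /(_ _ e0).
by apply: filterS => n; rewrite -rmorphB norm_conjC.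
Qed.

End ComplexLimits.

Section SquareSummable.
Variables (R : realType) (E : nat -> hilbertType R).
Implicit Types f g : forall k, E k.

Definition square_summable f :=
  cvgn (series (fun k => `|f k| ^+ 2 : R[i]^o)).

Let n2 (V : hilbertType R) (x : V) : R := complex.Re (inner x x).

Let n2E (V : hilbertType R) (x : V) : (n2 x)%:C = `|x| ^+ 2.
Proof. by rewrite /n2 RRe_real ?inner_normE// ger0_real// exprn_ge0. Qed.

Let n2_ge0 (V : hilbertType R) (x : V) : 0 <= n2 x.
Proof. by rewrite -lecR n2E exprn_ge0. Qed.

Let Re_add (x y : R[i]) :
  complex.Re (x + y) = complex.Re x + complex.Re y.
Proof. exact: (raddfD (@complex.Re R : Rcomplex R -> R)). Qed.

Let ReD (V : hilbertType R) (x y : V) :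
  n2 (x + y) = n2 x + n2 y + complex.Re (inner x y) *+ 2.
Proof.
rewrite /n2 dnormD !Re_add mulr2n; congr (_ + (_ + _)).
by case: (inner x y).
Qed.

Let ReZ (V : hilbertType R) (a : R[i]) (x : V) :
  n2 (a *: x) = complex.Re (`|a| ^+ 2) * n2 x.
Proof.
apply: complexI; rewrite rmorphM !n2E normrZ exprMn.
congr (_ * _); last exact/esym/n2E.
by symmetry; apply: RRe_real; rewrite ger0_real// exprn_ge0.
Qed.

Let ImE (V : hilbertType R) (x y : V) :
  complex.Im (inner x y) = complex.Re (inner x ('i%C *: y)).
Proof.
rewrite linearZr_LR/=; case: (inner x y) => a b.
have -> : Num.conj ('i%C : R[i]) = (0 -i* 1)%C by [].
by rewrite /GRing.mul/= mul0r mulN1r sub0r opprK.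
Qed.

Lemma series_sqE f :
  series (fun k => `|f k| ^+ 2 : R[i]^o) =
  fun n => (series (fun k => n2 (f k)) n)%:C : R[i]^o.
Proof.
apply/funext => n; rewrite /series/= rmorph_sum/=.
by apply: eq_bigr => k _; rewrite n2E.
Qed.

Lemma square_summableP f : square_summable f <->
  exists M : R[i], forall n, \sum_(0 <= k < n) `|f k| ^+ 2 <= M.
Proof.
split=> [cf|[M fM]].
  have cr : cvgn (series (fun k => n2 (f k))).
    apply/cvg_ex; exists (complex.Re (limn (series (fun k => `|f k| ^+ 2 : R[i]^o)))).
    rewrite [X in X @ _](_ : _ = fun n =>
      complex.Re (series (fun k => `|f k| ^+ 2 : R[i]^o) n)).
      exact: cvg_Re.
    by rewrite series_sqE.
  exists (limn (series (fun k => n2 (f k))))%:C => n.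
  have := congr1 (fun F => F n) (series_sqE f); rewrite /= {1}/series/= => ->.
  rewrite lecR; apply: nondecreasing_cvgn_le => //.
  by apply: nondecreasing_series => k _ _.
rewrite /square_summable series_sqE.
have /cvg_ex[l ul] : cvgn (series (fun k => n2 (f k))).
  apply: nondecreasing_is_cvgn; first by apply: nondecreasing_series => k _ _.
  exists (complex.Re M) => _ [n _ <-].
  have := fM n; have := congr1 (fun F => F n) (series_sqE f).
  by rewrite /= {1}/series/= => ->; rewrite lecE => /andP[].
by apply/cvg_ex; exists (l%:C); exact: cvg_realC.
Qed.

Let cvg_n2 f : square_summable f -> cvgn (series (fun k => n2 (f k))).
Proof.
move=> /square_summableP[M fM].
apply: nondecreasing_is_cvgn; first by apply: nondecreasing_series => k _ _.
exists (complex.Re M) => _ [n _ <-].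
have := fM n; have := congr1 (fun F => F n) (series_sqE f).
by rewrite /= {1}/series/= => ->; rewrite lecE => /andP[].
Qed.

Lemma square_summable0 : square_summable (fun=> 0).
Proof.
apply/square_summableP; exists 0 => n.
by rewrite big1// => k _; rewrite normr0 expr0n.
Qed.

Lemma square_summableZ (a : R[i]) f :
  square_summable f -> square_summable (fun k => a *: f k).
Proof.
move=> /square_summableP[M fM]; apply/square_summableP.
exists (`|a| ^+ 2 * M) => n.
under eq_bigr do rewrite normrZ exprMn.
by rewrite -mulr_sumr ler_wpM2l ?exprn_ge0.
Qed.

Lemma square_summableD f g : square_summable f -> square_summable g ->
  square_summable (fun k => f k + g k).
Proof.
move=> /square_summableP[M fM] /square_summableP[N gN]; apply/square_summableP.
exists (M *+ 2 + N *+ 2) => n.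
apply: (@le_trans _ _ (\sum_(0 <= k < n) (`|f k| ^+ 2 *+ 2 + `|g k| ^+ 2 *+ 2))).
  apply: ler_sum => k _; rewrite -!inner_normE.
  have := dnorm_ge0 inner (f k - g k); rewrite dnormB dnormD => h.
  by rewrite -mulrnDl [leRHS]mulr2n lerD2l -subr_ge0.
by rewrite big_split/= !sumrMnl lerD// lerMn2r ?fM ?gN.
Qed.

Let seriesC (u : nat -> R[i]^o) : series u = fun n =>
  (series (fun k => complex.Re (u k)) n +i*
   series (fun k => complex.Im (u k)) n)%C : R[i]^o.
Proof.
apply/funext; elim => [|n ih]; first by rewrite /series/= !big_nil.
by rewrite !seriesSr ih; case: (u n).
Qed.

Lemma square_summable_inner f g : square_summable f -> square_summable g ->
  cvgn (series (fun k => inner (f k) (g k) : R[i]^o)).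
Proof.
have cRe f' g' : square_summable f' -> square_summable g' ->
    cvgn (series (fun k => complex.Re (inner (f' k) (g' k)))).
  move=> sf sg.
  have -> : (fun k => complex.Re (inner (f' k) (g' k))) =
      2^-1 *: ((fun k => n2 (f' k + g' k)) -
        ((fun k => n2 (f' k)) + (fun k => n2 (g' k)))) :> (nat -> R).
    apply/funext => k; rewrite /= !fctE ReD addrAC subrr add0r -[X in _ *: X]mulr_natl.
    by rewrite /GRing.scale/= mulrA mulVf ?mul1r// pnatr_eq0.
  apply: is_cvg_seriesZ; apply: is_cvg_seriesB.
    by apply: cvg_n2; exact: square_summableD.
  by apply: is_cvg_seriesD; exact: cvg_n2.
move=> sf sg.
rewrite seriesC.
apply: cvg_complex; first exact: cRe.
rewrite (_ : (fun k => complex.Im _) =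
  fun k => complex.Re (inner (f k) ('i%C *: g k))); last first.
  by apply/funext => k; exact: ImE.
by apply: (cRe f (fun k => 'i%C *: g k) sf); exact: square_summableZ.
Qed.

Lemma finite_square_summable N f : (forall k, (N <= k)%N -> f k = 0) ->
  square_summable f.
Proof.
move=> f0; apply/square_summableP.
exists (\sum_(0 <= k < N) `|f k| ^+ 2) => n.
have h m : (N <= m)%N ->
    \sum_(0 <= k < m) `|f k| ^+ 2 = \sum_(0 <= k < N) `|f k| ^+ 2 :> R[i].
  move=> Nm; rewrite (big_cat_nat (leq0n N) Nm)/= -[RHS]addr0; congr (_ + _).
  rewrite big_nat_cond big1// => k /andP[/andP[Nk _] _].
  by rewrite f0// normr0 expr0n.
rewrite -(h _ (leq_maxr n N)) (big_cat_nat (leq0n n) (leq_maxl n N))//= lerDl.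
by apply: sumr_ge0 => k _; rewrite exprn_ge0.
Qed.

End SquareSummable.
Arguments square_summable0 {R} E.
Arguments square_summableZ {R E} a {f}.
Arguments square_summableD {R E f g}.
Arguments square_summable_inner {R E f g}.
Arguments finite_square_summable {R E} N {f}.


Section L2Sum.
Variables (R : realType) (E : nat -> hilbertType R).

Record l2sum : Type := L2Sum {
  l2fun :> forall k, E k;
  l2funP : square_summable l2fun }.
Arguments l2funP : clear implicits.

Implicit Types f g h : l2sum.

Lemma l2sum_eq f g : (forall k, f k = g k) -> f = g.
Proof.
case: f => f sf; case: g => g sg /= fg.
have {}fg : f = g by exact: functional_extensionality_dep.
by rewrite -{}fg in sg *; congr L2Sum; exact: Prop_irrelevance.
Qed.

HB.instance Definition _ := gen_eqMixin l2sum.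
HB.instance Definition _ := gen_choiceMixin l2sum.

Definition l2sum_zero := L2Sum (square_summable0 E).
Definition l2sum_scale (a : R[i]) f :=
  L2Sum (square_summableZ a (l2funP f)).
Definition l2sum_add f g := L2Sum (square_summableD (l2funP f) (l2funP g)).

Lemma l2sum_addA : associative l2sum_add.
Proof. by move=> f g h; apply: l2sum_eq => k; exact: addrA. Qed.

Lemma l2sum_addC : commutative l2sum_add.
Proof. by move=> f g; apply: l2sum_eq => k; exact: addrC. Qed.

Lemma l2sum_add0 : left_id l2sum_zero l2sum_add.
Proof. by move=> f; apply: l2sum_eq => k; exact: add0r. Qed.

Lemma l2sum_addN : left_inverse l2sum_zero (l2sum_scale (-1)) l2sum_add.
Proof.
by move=> f; apply: l2sum_eq => k; rewrite /= scaleN1r addNr.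
Qed.

HB.instance Definition _ := GRing.isZmodule.Build l2sum
  l2sum_addA l2sum_addC l2sum_add0 l2sum_addN.

Lemma l2sum_scaleA a b f :
  l2sum_scale a (l2sum_scale b f) = l2sum_scale (a * b) f.
Proof. by apply: l2sum_eq => k; exact: scalerA. Qed.

Lemma l2sum_scale1 : left_id 1 l2sum_scale.
Proof. by move=> f; apply: l2sum_eq => k; exact: scale1r. Qed.

Lemma l2sum_scaleDr : right_distributive l2sum_scale +%R.
Proof. by move=> a f g; apply: l2sum_eq => k; exact: scalerDr. Qed.

Lemma l2sum_scaleDl f :
  {morph l2sum_scale^~ f : a b / a + b}.
Proof. by move=> a b; apply: l2sum_eq => k; exact: scalerDl. Qed.

HB.instance Definition _ := GRing.Zmodule_isLmodule.Build R[i] l2sum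
  l2sum_scaleA l2sum_scale1 l2sum_scaleDr l2sum_scaleDl.

Lemma l2sumDE f g k : (f + g) k = f k + g k. Proof. by []. Qed.

Lemma l2sumZE (a : R[i]) f k : (a *: f) k = a *: f k. Proof. by []. Qed.

Lemma l2sumNE f k : (- f) k = - f k. Proof. exact: scaleN1r. Qed.

Lemma l2sumBE f g k : (f - g) k = f k - g k.
Proof. by rewrite l2sumDE l2sumNE. Qed.

Definition l2inner f g : R[i] :=
  limn (series (fun k => inner (f k) (g k) : R[i]^o)).

Lemma cvg_l2inner f g :
  series (fun k => inner (f k) (g k) : R[i]^o) @ \oo --> (l2inner f g : R[i]^o).
Proof. exact: square_summable_inner (l2funP f) (l2funP g). Qed.
Arguments cvg_l2inner : clear implicits.

Let cvgC_unique (u : nat -> R[i]^o) (l m : R[i]) :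
  u @ \oo --> (l : R[i]^o) -> u @ \oo --> (m : R[i]^o) -> l = m.
Proof. exact: (@cvg_unique R[i]^o (@norm_hausdorff _ R[i]^o)). Qed.

Lemma l2innerC f g : l2inner f g = (-1) ^+ false * Num.conj (l2inner g f).
Proof.
rewrite mul1r; apply/esym.
apply: (cvgC_unique _ (cvg_l2inner f g)).
rewrite [X in X @ _](_ : _ = fun n => Num.conj
  (series (fun k => inner (g k) (f k) : R[i]^o) n : R[i])).
  exact: (cvg_conj (cvg_l2inner g f)).
apply/funext => n; rewrite /series/= rmorph_sum.
by apply: eq_bigr => k _; rewrite hermC mul1r.
Qed.

Lemma l2inner_linearl g (a : R[i]) f f' :
  l2inner (a *: f + f') g = a * l2inner f g + l2inner f' g.
Proof.
apply: (cvgC_unique (cvg_l2inner _ _)).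
rewrite [X in X @ _](_ : _ = (fun n =>
    a *: series (fun k => inner (f k) (g k) : R[i]^o) n)
    \+ series (fun k => inner (f' k) (g k) : R[i]^o)).
  by apply: cvgD; [apply: cvgZr|]; exact: cvg_l2inner.
apply/funext => n; rewrite /series/= scaler_sumr -big_split/=.
by apply: eq_bigr => k _; rewrite linearDl linearZl_LR.
Qed.

Lemma l2inner_bilinear :
  bilinear_for (GRing.Scale.Law.clone _ _ *%R _)
    (GRing.Scale.Law.clone _ _ (@Num.conj R[i] \; *%R) _) l2inner.
Proof.
split=> [g|g] a f f'; first exact: l2inner_linearl.
rewrite [LHS]l2innerC [in RHS](l2innerC g f) [in RHS](l2innerC g f') !mul1r.
by rewrite l2inner_linearl rmorphD rmorphM.
Qed.

HB.instance Definition _ := bilinear_isBilinear.Build R[i] l2sum l2sum R[i]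
  _ _ l2inner l2inner_bilinear.

HB.instance Definition _ := isHermitianSesquilinear.Build R[i] l2sum false
  (@Num.conj R[i]) l2inner l2innerC.

Let sumsq f n : R := series (fun k => complex.Re (inner (f k) (f k))) n.

Let sumsqE f n : (sumsq f n)%:C = \sum_(0 <= k < n) `|f k| ^+ 2.
Proof. exact/esym/(congr1 (fun u => u n) (series_sqE f)). Qed.

Let sumsq_nd f : nondecreasing_seq (sumsq f).
Proof.
apply: nondecreasing_series => k _ _.
by rewrite -lecR RRe_real ?ger0_real// dnorm_ge0.
Qed.

Let l2innerE f : exists2 l : R, sumsq f @ \oo --> l & l2inner f f = l%:C.
Proof.
have sE : series (fun k => inner (f k) (f k) : R[i]^o) =
    fun n => (sumsq f n)%:C : R[i]^o.
  rewrite -series_sqE; congr series.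
  by apply/funext => k; exact: inner_normE.
have := cvg_l2inner f f; rewrite sE => h.
exists (complex.Re (l2inner f f)); first exact: (cvg_Re h).
apply: (cvgC_unique h); apply: cvg_realC; exact: (cvg_Re h).
Qed.

Lemma l2inner_ge_sum f n : \sum_(0 <= k < n) `|f k| ^+ 2 <= l2inner f f.
Proof.
have [l ul ->] := l2innerE f; rewrite -sumsqE lecR -(cvg_lim _ ul)//.
by apply: nondecreasing_cvgn_le => //; apply/cvg_ex; exists l.
Qed.

Lemma l2inner_le_sum f (M : R[i]) :
  (forall n, \sum_(0 <= k < n) `|f k| ^+ 2 <= M) -> l2inner f f <= M.
Proof.
move=> fM; have [l ul ->] := l2innerE f.
have M0 : 0 <= M by have := fM 0%N; rewrite big_nil.
rewrite lecE/= (ger0_Im M0) eqxx/= -(cvg_lim _ ul)//.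
apply: limr_le; first by apply/cvg_ex; exists l.
by near=> n; have := fM n; rewrite -sumsqE lecE/= => /andP[].
Unshelve. all: by end_near. Qed.

Lemma l2inner_gt0 f : f != 0 -> 0 < l2inner f f.
Proof.
move=> f0; have /existsNP[k /eqP fk] : ~ forall k, f k = 0.
  by apply: contra_not (elimN eqP f0) => h; exact: l2sum_eq.
apply: lt_le_trans (l2inner_ge_sum f k.+1).
rewrite big_nat_recr//= ltr_wpDl ?sumr_ge0//.
  by move=> i _; rewrite exprn_ge0.
by rewrite exprn_gt0// normr_gt0.
Qed.

HB.instance Definition _ := isDotProduct.Build R[i] l2sum l2inner l2inner_gt0.

Definition l2norm f : R[i] := sqrtC (l2inner f f).

HB.instance Definition _ := Lmodule_isNormed.Build R[i] l2sum
  (sqrt_dnormD l2inner) (sqrt_dnormZ l2inner) (@sqrt_dnorm0_eq0 _ _ l2inner).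

Lemma l2inner_normE f : l2inner f f = `|f| ^+ 2.
Proof. by rewrite sqrtCK. Qed.

Let coord_le f k : `|f k| <= `|f|.
Proof.
rewrite -ler_sqr ?nnegrE ?normr_ge0// -l2inner_normE.
apply: le_trans (l2inner_ge_sum f k.+1).
by rewrite big_nat_recr//= lerDr sumr_ge0// => i _; rewrite exprn_ge0.
Qed.

Let le_limC (T : Type) (F : set_system T) (FF : ProperFilter F)
    (u : T -> R[i]^o) (l M : R[i]) : 0 <= l -> 0 <= M ->
  u @ F --> (l : R[i]^o) -> (\forall x \near F, (u x : R[i]) <= M) -> l <= M.
Proof.
move=> l0 M0 ul uM; rewrite real_leNgt ?ger0_real//; apply/negP => Ml.
move/cvgrPdist_lt : ul => /(_ (l - M)); rewrite subr_gt0 => /(_ Ml) h.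
have [x [ulx uMx]] := filter_ex (filterI h uM).
have : l - M <= l - (u x : R[i]) by rewrite lerD2l lerN2.
move=> /le_lt_trans => lu.
have lux : 0 <= l - (u x : R[i]) by rewrite subr_ge0 (le_trans uMx)// ltW.
have : l - M < l - M.
  apply: lu; apply: le_lt_trans ulx.
  by rewrite -[leLHS]ger0_norm.
by rewrite ltxx.
Qed.

Let cvg_sumC (T : Type) (F : set_system T) (FF : ProperFilter F)
    (u : nat -> T -> R[i]^o) (l : nat -> R[i]^o) n :
  (forall k, u k @ F --> l k) ->
  (fun t => \sum_(0 <= k < n) u k t) @ F --> \sum_(0 <= k < n) l k.
Proof.
move=> ul; elim: n => [|n ih].
  have -> : (fun t => \sum_(0 <= k < 0) u k t) = fun=> 0.
    by apply/funext => t; rewrite big_nil.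
  by rewrite big_nil; exact: cvg_cst.
have -> : (fun t => \sum_(0 <= k < n.+1) u k t) =
    (fun t => \sum_(0 <= k < n) u k t) \+ u n.
  by apply/funext => t; rewrite big_nat_recr.
have -> : \sum_(0 <= k < n.+1) l k = \sum_(0 <= k < n) l k + l n.
  by rewrite big_nat_recr.
apply: (@cvgD R[i] R[i]^o T F FF).
exact: ih.
exact: ul.
Qed.

Lemma l2sum_complete (F : set_system l2sum) :
  ProperFilter F -> cauchy F -> cvg F.
Proof.
move=> FF /cauchyP Fc.
have coord_cvg k : cvg ((fun f : l2sum => f k) @ F).
  apply: cauchy_cvg; apply/cauchyP => e e0.
  have [f fe] := Fc e e0; exists ((f : l2sum) k).
  suff : F [set g : l2sum | ball ((f : l2sum) k) e (g k)] by [].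
  apply: filterS fe => g; rewrite -!ball_normE/= => fge.
  by apply: le_lt_trans fge; have := coord_le (f - g) k; rewrite l2sumBE.
pose x k := lim ((fun f : l2sum => f k) @ F).
have small e : 0 < e -> exists f0 : l2sum, F (ball f0 e) /\
    forall f, ball f0 e f -> forall n,
      \sum_(0 <= k < n) `|f k - x k| ^+ 2 <= (e + e) ^+ 2.
  move=> e0; have [f0 f0e] := Fc e e0; exists f0; split=> // f fe n.
  apply: (@le_limC _ F FF
    (fun g => \sum_(0 <= k < n) `|f k - g k| ^+ 2 : R[i]^o)).
  - by apply: sumr_ge0 => k _; rewrite exprn_ge0.
  - by rewrite exprn_ge0// addr_ge0// ltW.
  - apply: (@cvg_sumC l2sum F FF (fun k g => `|f k - g k| ^+ 2 : R[i]^o)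
      (fun k => `|f k - x k| ^+ 2 : R[i]^o)) => k.
    have h : (fun g : l2sum => `|f k - g k| : R[i]^o) @ F -->
        (`|f k - x k| : R[i]^o).
      apply: cvg_norm; apply: cvgB; first exact: cvg_cst.
      exact: coord_cvg.
    exact: (cvgM h h).
  - apply: filterS f0e => g ge.
    apply: (@le_trans _ _ (`|f - g| ^+ 2)).
      rewrite -l2inner_normE; apply: le_trans (l2inner_ge_sum _ n).
      by apply: ler_sum => k _; rewrite l2sumBE.
    rewrite ler_sqr ?nnegrE ?normr_ge0 ?addr_ge0 ?(ltW e0)//.
    rewrite ltW//; move: fe ge; rewrite -!ball_normE/= => fe ge.
    apply: le_lt_trans (ler_distD f0 f g) _.
    by rewrite ltrD// distrC.
have sx : square_summable x.
  have [f0 [_ /(_ f0 (ballxx _ ltr01)) h]] := small 1 ltr01.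
  have sfx : square_summable (fun k => f0 k - x k).
    by apply/square_summableP; exists ((1 + 1) ^+ 2).
  rewrite (_ : x = fun k => f0 k + (-1) *: (f0 k - x k)).
    exact: square_summableD (l2funP f0) (square_summableZ _ sfx).
  apply: functional_extensionality_dep => k.
  by rewrite scaleN1r opprB addrC subrK.
apply/cvg_ex; exists (L2Sum sx); apply/cvg_ballP => e e0.
have e4 : 0 < e / 4 by rewrite divr_gt0.
have [f0 [f0e h]] := small _ e4.
apply: filterS f0e => f fe; rewrite -ball_normE/= distrC.
apply: (@le_lt_trans _ _ (e / 4 + e / 4)).
  rewrite -ler_sqr ?nnegrE ?normr_ge0 ?addr_ge0 ?(ltW e4)//.
  rewrite -l2inner_normE; apply: l2inner_le_sum => n.
  apply: le_trans (h f fe n).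
  by apply: ler_sum => k _; rewrite l2sumBE.
rewrite -mulrDr gtr_pMr// -mulr2n -(mulr_natr 4^-1).
by rewrite mulrC ltr_pdivrMr// mul1r ltr_nat.
Qed.

HB.instance Definition _ := Uniform_isComplete.Build l2sum l2sum_complete.

HB.instance Definition _ := NormedModule_isHilbert.Build R l2sum l2inner_normE.

End L2Sum.

Definition separable_space (R : realType) (V : hilbertType R) :=
  exists2 A : set V, countable A & dense A.

Section Operators.
Variable R : realType.
Implicit Types U V : hilbertType R.

Definition bounded_op U V (T : U -> V) :=
  linear T /\ exists M : R[i], forall x, `|T x| <= M * `|x|.

Definition contraction_op U V (T : U -> V) :=
  linear T /\ forall x, `|T x| <= `|x|.

Definition is_adjoint U V (T : U -> V) (S : V -> U) :=
  forall x y, inner (T x) y = inner x (S y).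

(* For a bounded T the set below is a singleton by the Riesz representation
   theorem; the default value 0 is only there to make the function total. *)
Definition adjoint U V (T : U -> V) : V -> U :=
  fun y => xget 0 [set z | forall x, inner (T x) y = inner x z].

Definition kernel_op U V (T : U -> V) : set U := [set x | T x = 0].

Definition orthocomplement U (A : set U) : set U :=
  [set x | forall y, A y -> inner x y = 0].

(* The order of R[i] makes [0 <= z] mean that z is real and nonnegative. *)
Definition positive_op U (T : U -> U) :=
  bounded_op T /\ forall x, 0 <= inner (T x) x.

(* A positive operator has exactly one positive square root, so that the
   default value is again irrelevant for such T. *)
Definition sqrt_op U (T : U -> U) : U -> U :=
  xget (cst 0) [set S | positive_op S /\ S \o S = T].

Definition partial_isometry U V (T : U -> V) :=
  bounded_op T /\
  forall x, orthocomplement (kernel_op T) x -> `|T x| = `|x|.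

Definition orthogonal_projection U (P : U -> U) :=
  [/\ bounded_op P, P \o P = P & is_adjoint P P].

Definition spectrum U (T : U -> U) : set R[i] :=
  [set z | ~ exists S : U -> U,
    [/\ bounded_op S, forall x, S (T x - z *: x) = x
      & forall x, T (S x) - z *: S x = x]].

Definition defect U V (J : U -> V) : U -> U :=
  sqrt_op (fun x => x - adjoint J (J x)).

Definition codefect U V (J : U -> V) : V -> V :=
  sqrt_op (fun y => y - J (adjoint J y)).

End Operators.

(* The sequence (H_1, H_2, ...) of the mathematical text is (H 0, H 1, ...)
   here. Component 0 of the parent space is the one of index infinity, and
   component k.+1 is H k. *)
Section ParentSpace.
Variables (R : realType) (Hinf : hilbertType R) (H : nat -> hilbertType R).
Variable J : forall k, H k -> Hinf.

Definition parent_component (i : nat) : hilbertType R :=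
  if i is k.+1 then H k else Hinf.

Definition parent : hilbertType R := l2sum parent_component.

Definition parent_iota_fun k (x : H k) (i : nat) : parent_component i :=
  match i with
  | 0 => J x
  | j.+1 => dfwith (fun j' => 0 : H j') (defect (@J k) x) j
  end.

Definition parent_iota_inf_fun (x : Hinf) (i : nat) : parent_component i :=
  match i with
  | 0 => x
  | j.+1 => 0
  end.

Lemma parent_iota_summable k (x : H k) : square_summable (parent_iota_fun x).
Proof.
apply: (finite_square_summable k.+2) => -[//|j] /= kj.
by rewrite dfwith_out// ltn_eqF.
Qed.
Arguments parent_iota_summable : clear implicits.

Lemma parent_iota_inf_summable (x : Hinf) :
  square_summable (parent_iota_inf_fun x).
Proof. by apply: (finite_square_summable 1) => -[]. Qed.
Arguments parent_iota_inf_summable : clear implicits.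

Definition parent_iota k : H k -> parent :=
  fun x => L2Sum (parent_iota_summable k x).

Definition parent_iota_inf : Hinf -> parent :=
  fun x => L2Sum (parent_iota_inf_summable x).

Definition parent_proj k : parent -> parent :=
  @parent_iota k \o adjoint (@parent_iota k).

Definition parent_proj_inf : parent -> parent :=
  parent_iota_inf \o adjoint parent_iota_inf.

End ParentSpace.
Arguments parent_proj {R Hinf H} J k.
Arguments parent_proj_inf {R Hinf} H.

(* Main.v *)
Require Import Defs.
From mathcomp Require Import all_boot all_order all_algebra.
From mathcomp Require Import complex.
From mathcomp Require Import boolp classical_sets functions cardinality reals.
From mathcomp Require Import topology normedtype sequences.
From mathcomp Require Import ring lra.
Import Order.TTheory GRing.Theory Num.Theory.
Import numFieldNormedType.Exports.
Local Open Scope classical_set_scope.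
Local Open Scope complex_scope.
Local Open Scope ring_scope.

(* Writing S for the adjoint of J = J_n, each of the nine assertions is
   equivalent to J S J = J, and this condition is invariant under exchanging J
   and S; the assertions (5)-(8) are (1)-(4) for S. Since W^2 = 1 - S J, one has
   |J x|^2 + |W x|^2 = |x|^2, and J S J = J says that J W^2 = 0. In (9), the
   commutator of the projections consists of the two entries J W and W S, which
   are adjoint to each other.
   Adjoints exist by the Riesz representation theorem, where a functional f is
   represented by the minimiser of |x|^2 - 2 Re f(x). The defect operators exist
   because 1 - B has a positive square root for every selfadjoint contraction
   B. *)

Set Implicit Arguments.
Unset Strict Implicit.

(** * Real norm and real inner product *)

Section RealParts.
Variable R : realType.
Implicit Types U V W : hilbertType R.

Lemma Re_add (a b : R[i]) : complex.Re (a + b) = complex.Re a + complex.Re b.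
Proof. by case: a b => ? ? []. Qed.

Lemma Re_opp (a : R[i]) : complex.Re (- a) = - complex.Re a.
Proof. by case: a. Qed.

Lemma Re_realM (t : R) (a : R[i]) : complex.Re (t%:C * a) = t * complex.Re a.
Proof. by case: a => a b; rewrite /= mul0r subr0. Qed.

Lemma Re_conj (a : R[i]) : complex.Re (Num.conj a) = complex.Re a.
Proof. by case: a. Qed.

(** The norm of a normed module over [R[i]] is [R[i]]-valued; its real version gives access to
    [lra], [nra] and real limits. *)
Definition nr V (x : V) : R := complex.Re `|x|.
Definition rip V (x y : V) : R := complex.Re (inner x y).

Lemma nrE V (x : V) : (nr x)%:C = `|x|.
Proof. by rewrite /nr RRe_real// ger0_real. Qed.

Lemma nr_ge0 V (x : V) : 0 <= nr x.
Proof. by rewrite -lecR nrE normr_ge0. Qed.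

Lemma nr_le_complex V W (x : V) (y : W) : (`|x| <= `|y|) = (nr x <= nr y).
Proof. by rewrite -!nrE lecR. Qed.

Lemma inner_nr V (x : V) : inner x x = (nr x ^+ 2)%:C.
Proof. by rewrite inner_normE -nrE rmorphXn. Qed.

Lemma ripxx V (x : V) : rip x x = nr x ^+ 2.
Proof. by rewrite /rip inner_nr. Qed.

Lemma nr0 V : nr (0 : V) = 0. Proof. by rewrite /nr normr0. Qed.

Lemma nr_eq0 V (x : V) : nr x = 0 -> x = 0.
Proof. by move=> x0; apply: normr0_eq0; rewrite -nrE x0. Qed.

Lemma nrN V (x : V) : nr (- x) = nr x. Proof. by rewrite /nr normrN. Qed.

Lemma nrD V (x y : V) : nr (x + y) <= nr x + nr y.
Proof. by rewrite -lecR rmorphD/= !nrE ler_normD. Qed.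

Lemma nrZ V (t : R) (x : V) : nr (t%:C *: x) = `|t| * nr x.
Proof.
apply: complexI; rewrite rmorphM/= !nrE normrZ; congr (_ * _).
by rewrite normc_def/= expr0n/= addr0 sqrtr_sqr.
Qed.

Lemma innerC V (x y : V) : inner x y = Num.conj (inner y x).
Proof. by rewrite hermC mul1r. Qed.

Lemma ripC V (x y : V) : rip x y = rip y x.
Proof. by rewrite /rip innerC Re_conj. Qed.

Lemma ripDl V (x y z : V) : rip (x + y) z = rip x z + rip y z.
Proof. by rewrite /rip linearDl Re_add. Qed.

Lemma ripNl V (x z : V) : rip (- x) z = - rip x z.
Proof. by rewrite /rip linearNl Re_opp. Qed.

Lemma ripZl V (t : R) (x z : V) : rip (t%:C *: x) z = t * rip x z.
Proof. by rewrite /rip linearZl_LR/= Re_realM. Qed.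

Lemma ripDr V (x y z : V) : rip z (x + y) = rip z x + rip z y.
Proof. by rewrite ripC ripDl !(ripC z). Qed.

Lemma ripNr V (x z : V) : rip z (- x) = - rip z x.
Proof. by rewrite ripC ripNl ripC. Qed.

Lemma ripZr V (t : R) (x z : V) : rip z (t%:C *: x) = t * rip z x.
Proof. by rewrite ripC ripZl ripC. Qed.

Definition ripE := (ripDl, ripDr, ripNl, ripNr, ripZl, ripZr).

Lemma rip_i V (x y : V) : rip ('i%C *: x) y = - complex.Im (inner x y).
Proof. by rewrite /rip linearZl_LR/=; case: (inner x y) => a b /=; ring. Qed.

(** Multiplying [x] by ['i] turns imaginary parts into real ones, so an identity between inner
    products of linear maps need only be checked for [rip]. *)
Lemma inner_rip V (x y : V) :
  inner x y = (rip x y -i* rip ('i%C *: x) y)%C.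
Proof. by rewrite rip_i opprK /rip; case: (inner x y). Qed.

Lemma rip_le V (x y : V) : rip x y <= nr x * nr y.
Proof.
apply: (le_trans (ler_norm _)).
rewrite -ler_sqr ?nnegrE ?mulr_ge0 ?nr_ge0// -lecR rmorphXn/=.
apply: le_trans (_ : `|inner x y| ^+ 2 <= _).
  by rewrite ler_sqr ?nnegrE ?normr_ge0 ?ler0c ?normr_ge0//; exact: normc_ge_Re.
apply: (le_trans (dot_CauchySchwarz _ _ _)).
by rewrite !inner_nr -rmorphM/= exprMn.
Qed.

Lemma rip_abs_le V (x y : V) : `|rip x y| <= nr x * nr y.
Proof. by rewrite ler_norml lerNl -ripNl -{1}(nrN x) !rip_le. Qed.

Lemma nr_sqD V (x y : V) : nr (x + y) ^+ 2 = nr x ^+ 2 + nr y ^+ 2 + 2 * rip x y.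
Proof. by rewrite -!ripxx !ripE (ripC y x); ring. Qed.

Lemma rip_ext V (y z : V) : (forall x, rip x y = rip x z) -> y = z.
Proof.
move=> yz; apply/eqP; rewrite -subr_eq0; apply/eqP/nr_eq0.
by apply/eqP; rewrite -sqrf_eq0 -ripxx ripDr ripNr yz subrr.
Qed.

Lemma le_vanishing (a c : R) (d : nat -> R) : d @ \oo --> (0 : R) ->
  (forall n, a <= c * d n) -> a <= 0.
Proof.
move=> d0 ad.
have cd : (fun n => c * d n) @ \oo --> (0 : R).
  by rewrite -(mulr0 c); apply: cvgM => //; exact: cvg_cst.
rewrite -(cvg_lim _ cd)//; apply: limr_ge; first by apply/cvg_ex; exists 0.
by near=> n; exact: ad.
Unshelve. all: by end_near. Qed.

Lemma nr_vanishing V (x : V) (c : R) (d : nat -> R) : d @ \oo --> (0 : R) ->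
  (forall n, nr x <= c * d n) -> x = 0.
Proof.
move=> d0 xd; apply: nr_eq0; apply/eqP; rewrite eq_le nr_ge0 andbT.
exact: le_vanishing d0 xd.
Qed.

Lemma nrZC V (a : R[i]) (x : V) : nr (a *: x) = complex.Re `|a| * nr x.
Proof.
apply: complexI; rewrite rmorphM/= !nrE normrZ; congr (_ * _).
Qed.

(** The rate survives in the limit, so that later limit arguments reduce to [le_vanishing] and
    [nr_vanishing]. *)
Lemma complete_rate V (u : nat -> V) (d : nat -> R) : d @ \oo --> (0 : R) ->
  (forall m n, (m <= n)%N -> nr (u n - u m) <= d m) ->
  exists l, forall n, nr (l - u n) <= d n.
Proof.
move=> d0 ud.
have /cauchy_cvgP/cvg_ex[l ul] : cauchy (u @ \oo).
  apply/cauchyP => e e0.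
  have eE : e = (complex.Re e)%:C by rewrite RRe_real// gtr0_real.
  have e0' : 0 < complex.Re e by rewrite -ltcR -eE.
  move/cvgrPdist_lt : d0 => /(_ _ e0') [N _ /(_ N (leqnn N))/=].
  rewrite sub0r normrN => dN; exists (u N), N => // n /= Nn.
  rewrite -ball_normE/= distrC -nrE eE ltcR; apply: le_lt_trans (ud _ _ Nn) _.
  exact: le_lt_trans (ler_norm _) dN.
(* A violation at [n] would leave a positive gap; a later term closer to [l] than this gap
   contradicts the triangle inequality. *)
exists l => n; rewrite leNgt; apply/negP => dl.
have e0 : 0 < (nr (l - u n) - d n)%:C :> R[i] by rewrite ltcR subr_gt0.
move/cvgrPdist_lt : ul => /(_ _ e0)[N _ /(_ (maxn N n) (leq_maxl _ _))/=].
rewrite -nrE ltcR; apply/negP; rewrite -leNgt lerBlDr.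
rewrite -(subrK (u (maxn N n)) l) -addrA.
by apply: le_trans (nrD _ _) _; rewrite subrK lerD2l ud// leq_maxr.
Qed.

End RealParts.

(** * Riesz representation and adjoints *)

Section Riesz.
Variables (R : realType) (V : hilbertType R).

Lemma riesz_real (f : V -> R) (M : R) :
  (forall x y, f (x + y) = f x + f y) ->
  (forall t x, f (t%:C *: x) = t * f x) ->
  (forall x, f x <= M * nr x) ->
  exists z, forall x, f x = rip x z.
Proof.
move=> fD fZ fM.
pose Phi x := nr x ^+ 2 - 2 * f x.
have lbPhi : has_lbound (range Phi).
  exists (- M ^+ 2) => _ [x _ <-]; rewrite /Phi.
  by have := fM x; have := sqr_ge0 (nr x - M); nra.
have infPhi x : inf (range Phi) <= Phi x by apply: ge_inf => //; exists x.
pose d n : R := n.+1%:R^-1.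
have d_gt0 n : 0 < d n by rewrite invr_gt0 ltr0n.
have d_ge0 n : 0 <= d n by exact/ltW.
have d0 : d @ \oo --> (0 : R) by exact: cvg_harmonic.
(* The error is [d n ^+ 2] because distances enter [Phi] squared; the minimising sequence then
   converges at a rate linear in [d]. *)
have /choice[u uP] : forall n, exists x, Phi x <= inf (range Phi) + d n ^+ 2.
  move=> n; have [||_ [x _ <-] xn] := @inf_adherent _ (range Phi) (d n ^+ 2).
  - exact: exprn_gt0.
  - by split=> //; exists (Phi 0), 0.
  - by exists x; exact: ltW.
have [z zu] : exists z, forall n, nr (z - u n) <= 2 * d n.
  apply: complete_rate => [|m n mn].
    by rewrite -(mulr0 2); apply: cvgM => //; exact: cvg_cst.
  rewrite -ler_sqr ?nnegrE ?nr_ge0 ?mulr_ge0//.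
  (* Parallelogram law: [Phi (u n) + Phi (u m)] exceeds twice the value of [Phi] at the midpoint by
     half of [nr (u n - u m) ^+ 2], since the linear terms cancel. *)
  have := infPhi ((2^-1)%:C *: (u n + u m)); have := uP n; have := uP m.
  rewrite /Phi nrZ fZ fD exprMn normfV ger0_norm ?ler0n// nr_sqD => um un.
  have dnm : d n <= d m by rewrite /d lef_pV2 ?posrE ?ltr0n// ler_nat ltnS.
  have : d n ^+ 2 <= d m ^+ 2 by rewrite ler_sqr ?nnegrE ?d_ge0.
  rewrite nr_sqD nrN ripNr; set r := rip _ _; set a := nr _ ^+ 2 in um *.
  set b := nr _ ^+ 2 in un *; set e := d m ^+ 2 in um *.
  set e' := d n ^+ 2 in un *; rewrite exprMn -/e => e'e h.
  lra.
exists z => h.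
have [->|h0] := eqVneq h 0.
  by have := fZ 0 0; rewrite scaler0 mul0r => ->; rewrite /rip linear0l.
have nh : 0 < nr h.
  by rewrite lt_neqAle nr_ge0 andbT eq_sym; apply: contra_neq h0 => /nr_eq0.
have res n : `|rip h (u n) - f h| <= nr h * d n.
  set r := rip _ _ - _.
  rewrite -ler_sqr ?nnegrE ?normr_ge0 ?mulr_ge0 ?nr_ge0// real_normK ?num_real//.
  (* Moving from [u n] by [t] along [h] changes [Phi] by [2 * t * r + t ^+ 2 * nr h ^+ 2]. This [t]
     minimises the change, and the minimum is at least [- d n ^+ 2]. *)
  pose t := - r / nr h ^+ 2.
  have := infPhi (u n + t%:C *: h); have := uP n.
  rewrite /Phi fD fZ nr_sqD nrZ exprMn real_normK ?num_real// ripZr (ripC (u n)).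
  move=> un ut.
  have tE : t * nr h ^+ 2 = - r by rewrite divfK// expf_neq0// gt_eqF.
  have : 2 * t * r + t * (t * nr h ^+ 2) >= - d n ^+ 2 by rewrite /r; lra.
  rewrite tE => tr.
  rewrite exprMn -[leLHS](_ : - t * nr h ^+ 2 * r = _); last first.
    by rewrite mulNr tE; ring.
  have := sqr_ge0 (nr h).
  have : - t * r <= d n ^+ 2 by lra.
  by move=> tr' nh2; have := ler_wpM2r nh2 tr'; lra.
apply/eqP; rewrite -subr_eq0 -normr_eq0 eq_le normr_ge0 andbT.
(* The constant 3 adds the 2 from the rate of [z] and the 1 from [res]. *)
apply: (@le_vanishing _ _ (nr h * 3) _ d0) => n.
have -> : f h - rip h z = - (rip h (z - u n) + (rip h (u n) - f h)).
  by rewrite ripDr ripNr; ring.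
rewrite normrN; apply: le_trans (ler_normD _ _) _.
have := rip_abs_le h (z - u n).
have := res n; have := ler_wpM2l (ltW nh) (zu n); lra.
Qed.

End Riesz.

(** * Linear maps, adjoints and positive operators *)

Section LinearOperators.
Variable R : realType.
Implicit Types U V W : hilbertType R.

Lemma lin0 U V (T : U -> V) : linear T -> T 0 = 0.
Proof. by move=> /(_ (-1) 0 0); rewrite scaler0 addr0 scaleN1r addNr. Qed.

Lemma linD U V (T : U -> V) : linear T -> forall x y, T (x + y) = T x + T y.
Proof. by move=> lT x y; have := lT 1 x y; rewrite !scale1r. Qed.

Lemma linZ U V (T : U -> V) : linear T -> forall a x, T (a *: x) = a *: T x.
Proof. by move=> lT a x; have := lT a x 0; rewrite (lin0 lT) !addr0. Qed.

Lemma linN U V (T : U -> V) : linear T -> forall x, T (- x) = - T x.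
Proof. by move=> lT x; rewrite -scaleN1r (linZ lT) scaleN1r. Qed.

Lemma linB U V (T : U -> V) : linear T -> forall x y, T (x - y) = T x - T y.
Proof. by move=> lT x y; rewrite (linD lT) (linN lT). Qed.

Lemma lin_comp U V W (S : V -> W) (T : U -> V) :
  linear S -> linear T -> linear (S \o T).
Proof. by move=> lS lT a x y /=; rewrite lT lS. Qed.

Lemma linear_add U V (S T : U -> V) :
  linear S -> linear T -> linear (fun x => S x + T x).
Proof. by move=> lS lT a x y; rewrite lS lT scalerDr addrACA. Qed.

Lemma linear_scale U V (c : R[i]) (T : U -> V) :
  linear T -> linear (fun x => c *: T x).
Proof. by move=> lT a x y; rewrite lT scalerDr !scalerA (mulrC c). Qed.

Lemma linear_idB V (T : V -> V) : linear T -> linear (fun x => x - T x).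
Proof.
by move=> lT a x y; rewrite lT scalerBr opprD addrACA.
Qed.

Lemma bounded_opP U V (T : U -> V) : bounded_op T <->
  linear T /\ exists2 K : R, 0 <= K & forall x, nr (T x) <= K * nr x.
Proof.
split=> [[lT [M TM]]|[lT [K K0 TK]]]; split=> //.
  exists `|complex.Re M| => // x; have := TM x.
  rewrite -!nrE lecE => /andP[_]; rewrite mulrC Re_realM/= mulrC => /le_trans; apply.
  by rewrite ler_wpM2r ?nr_ge0// ler_norm.
by exists K%:C => x; rewrite -!nrE -rmorphM/= lecR.
Qed.

Lemma contraction_opP U V (T : U -> V) : contraction_op T <->
  linear T /\ forall x, nr (T x) <= nr x.
Proof.
by split=> -[lT T1]; split=> // x; have := T1 x; rewrite nr_le_complex.
Qed.

Lemma contraction_bounded U V (T : U -> V) : contraction_op T -> bounded_op T.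
Proof. by move=> [lT T1]; split=> //; exists 1 => x; rewrite mul1r. Qed.

Lemma inner_ext V (y z : V) : (forall x, inner x y = inner x z) -> y = z.
Proof. by move=> yz; apply: rip_ext => x; rewrite /rip yz. Qed.

Lemma is_adjoint_rip U V (T : U -> V) (S : V -> U) : linear T ->
  (forall x y, rip (T x) y = rip x (S y)) -> is_adjoint T S.
Proof.
by move=> lT TS x y; rewrite !inner_rip TS -(linZ lT) TS.
Qed.

Lemma is_adjointC U V (T : U -> V) (S : V -> U) :
  is_adjoint T S -> is_adjoint S T.
Proof.
by move=> TS x y; rewrite innerC -TS -innerC.
Qed.

Lemma adjointE U V (T : U -> V) (S : V -> U) :
  is_adjoint T S -> adjoint T = S.
Proof.
move=> TS; apply/funext => y; apply: xget_unique => [x|z zy]; first exact: TS.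
by apply: inner_ext => x; rewrite -TS zy.
Qed.

Lemma is_adjoint_linear U V (T : U -> V) (S : V -> U) :
  is_adjoint T S -> linear S.
Proof.
move=> TS a y z; apply: inner_ext => x.
by rewrite -TS !linearDr/= !linearZr_LR/= !TS.
Qed.

Lemma adjointP U V (T : U -> V) : bounded_op T -> is_adjoint T (adjoint T).
Proof.
move=> /bounded_opP[lT [K K0 TK]] x y.
have [z zy] : exists z, forall x, rip (T x) y = rip x z.
  apply: (@riesz_real _ _ _ (K * nr y)) => [a b|t a|a].
  - by rewrite (linD lT) ripDl.
  - by rewrite (linZ lT) ripZl.
  - apply: le_trans (rip_le _ _) _.
    by rewrite mulrAC ler_wpM2r ?nr_ge0.
suff /(xgetPex 0) : exists z, [set z | forall x, inner (T x) y = inner x z] z.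
  exact.
by exists z => w /=; rewrite !inner_rip zy -(linZ lT) zy.
Qed.

(** Cauchy-Schwarz in [|S y|^2 = <T (S y), y>] gives [|S y|^2 <= |S y| |y|], and [|S y|] can be
    cancelled. *)
Lemma contraction_adjoint U V (T : U -> V) (S : V -> U) :
  contraction_op T -> is_adjoint T S -> contraction_op S.
Proof.
move=> /contraction_opP[lT T1] TS; apply/contraction_opP.
split=> [|y]; first exact: is_adjoint_linear TS.
have [->|Sy0] := eqVneq (nr (S y)) 0; first exact: nr_ge0.
have Sy : 0 < nr (S y) by rewrite lt_neqAle eq_sym Sy0 nr_ge0.
rewrite -(ler_pM2l Sy) -expr2 -ripxx /rip -TS.
by apply: le_trans (rip_le _ _) _; rewrite ler_wpM2r ?nr_ge0.
Qed.

(** Polarisation: all [<T x, x>] are real, and expanding this at [x + y] makes the imaginary parts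
    of [<T x, y>] and [<x, T y>] agree. Replacing [x] by ['i *: x] yields the real parts. *)
Lemma positive_selfadjoint V (T : V -> V) : positive_op T -> is_adjoint T T.
Proof.
move=> [[lT _] T0].
have ImT x y : complex.Im (inner (T x) y) = complex.Im (inner x (T y)).
  rewrite [in RHS]innerC; have := ger0_Im (T0 (x + y)).
  rewrite (linD lT) linearDl/= !linearDr/=.
  have := ger0_Im (T0 x); have := ger0_Im (T0 y).
  case: (inner (T x) x) => ? ?; case: (inner (T x) y) => ? ?.
  case: (inner (T y) x) => ? ?; case: (inner (T y) y) => ? ? /=.
  lra.
move=> x y; apply/eqP; rewrite eq_complex ImT eqxx andbT; apply/eqP.
have := ImT ('i%C *: x) y; rewrite (linZ lT) !linearZl_LR/=.
by case: (inner (T x) y) => ? ?; case: (inner x (T y)) => ? ? /=; rewrite !mul0r !add0r !mul1r.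
Qed.

Lemma selfadjoint_positive V (T : V -> V) : bounded_op T -> is_adjoint T T ->
  (forall x, 0 <= rip (T x) x) -> positive_op T.
Proof.
move=> bT aT T0; split=> // x; rewrite lecE T0 andbT.
have := aT x x; rewrite [RHS]innerC => /(congr1 (@complex.Im R)).
by case: (inner (T x) x) => a b /= h; apply/eqP; lra.
Qed.

End LinearOperators.

(** * Square roots *)

Section SquareRoot.
Variables (R : realType) (V : hilbertType R) (B : V -> V).
Hypothesis B_contr : contraction_op B.
Hypothesis B_sym : is_adjoint B B.

Let half : R[i] := (2^-1 : R)%:C.

Let halfD : half + half = 1.
Proof. by rewrite /half -rmorphD/= (_ : _ + _ = 1)//; lra. Qed.

Fixpoint sqrt_iter (n : nat) : V -> V :=
  if n is m.+1 then fun x => half *: (B x + sqrt_iter m (sqrt_iter m x))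
  else fun=> 0.
Local Notation Y := sqrt_iter.

Fixpoint sqrt_majorant (n : nat) : R :=
  if n is m.+1 then 2^-1 * (1 + sqrt_majorant m ^+ 2) else 0.
Local Notation y := sqrt_majorant.

Let lB : linear B. Proof. by case: B_contr. Qed.

Let nrB x : nr (B x) <= nr x.
Proof. by move/contraction_opP : B_contr => -[]. Qed.

Let majorant_ge0 n : 0 <= y n.
Proof. by elim: n => //= n ih; have := sqr_ge0 (y n); lra. Qed.

Let majorant_le1 n : y n <= 1.
Proof. by elim: n => [|n ih] /=; [|have := majorant_ge0 n; nra]. Qed.

Let majorant_nd : nondecreasing_seq y.
Proof.
apply/nondecreasing_seqP => n /=; have := sqr_ge0 (y n - 1); lra.
Qed.

Let linY n : linear (Y n).
Proof.
elim: n => [|n ih] a x z /=; first by rewrite scaler0 addr0.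
by rewrite lB !ih addrACA -(scalerDr a) [LHS]scalerDr !scalerA (mulrC a).
Qed.

Let nr_half (x : V) : nr (half *: x) = 2^-1 * nr x.
Proof. by rewrite nrZ ger0_norm ?invr_ge0 ?ler0n. Qed.

Let nrY n x : nr (Y n x) <= y n * nr x.
Proof.
elim: n x => [|n ih] x /=; first by rewrite nr0 mul0r.
rewrite nr_half -mulrA ler_wpM2l ?invr_ge0 ?ler0n// mulrDl mul1r.
apply: le_trans (nrD _ _) _; apply: lerD; first exact: nrB.
apply: le_trans (ih _) _.
by rewrite expr2 -mulrA ler_wpM2l.
Qed.

(** Each [Y n] is a polynomial in [B]. Used twice, this makes the iterates commute, so that a
    difference of their squares factors. *)
Let Y_comm n (T : V -> V) : linear T -> (forall x, T (B x) = B (T x)) ->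
  forall x, T (Y n x) = Y n (T x).
Proof.
move=> lT TB; elim: n => [|n ih] x /=; first exact: lin0.
by rewrite (linZ lT) (linD lT) TB !ih.
Qed.

Let YY_comm m n x : Y m (Y n x) = Y n (Y m x).
Proof.
by apply: Y_comm => // z; symmetry; apply: Y_comm.
Qed.

Let Y_step n x : nr (Y n.+1 x - Y n x) <= (y n.+1 - y n) * nr x.
Proof.
elim: n x => [|n ih] x.
  rewrite subr0 /= addr0 nr_half expr0n/= addr0 subr0 mulr1 ler_wpM2l ?invr_ge0 ?ler0n//.
(* The difference of two squares as (difference)(sum); the scalar majorant factors in the same
   way. *)
have -> : Y n.+2 x - Y n.+1 x =
    half *: (Y n.+1 (Y n.+1 x + Y n x) - Y n (Y n.+1 x + Y n x)).
  rewrite [Y n.+2]/= [in X in _ - X]/= -scalerBr; congr (_ *: _).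
  rewrite (linD (linY n.+1)) (linD (linY n)) (YY_comm n.+1 n).
  by rewrite opprD addrACA subrr add0r opprD addrA addrK.
rewrite nr_half.
have -> : y n.+2 - y n.+1 = 2^-1 * ((y n.+1 - y n) * (y n.+1 + y n)).
  by rewrite /=; field.
rewrite -[leRHS]mulrA ler_wpM2l ?invr_ge0 ?ler0n//.
apply: le_trans (ih _) _; rewrite -mulrA ler_wpM2l ?subr_ge0 ?majorant_nd//.
by rewrite mulrDl; apply: le_trans (nrD _ _) _; rewrite lerD.
Qed.

Let Y_diff m n x : (m <= n)%N -> nr (Y n x - Y m x) <= (y n - y m) * nr x.
Proof.
elim: n => [|n ih]; first by rewrite leqn0 => /eqP ->; rewrite !subrr nr0 mul0r.
rewrite leq_eqVlt => /predU1P[->|]; first by rewrite !subrr nr0 mul0r.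
rewrite ltnS => /ih {}ih; rewrite -(subrK (Y n x) (Y n.+1 x)) -addrA.
apply: le_trans (nrD _ _) _.
have := Y_step n x; lra.
Qed.

Let majorant_cvg : cvgn y.
Proof.
by apply: nondecreasing_is_cvgn => //; exists 1 => _ [n _ <-].
Qed.

Let e n : R := limn y - y n.

Let e0 : e @ \oo --> (0 : R).
Proof. by rewrite -(subrr (limn y)); apply: cvgB => //; exact: cvg_cst. Qed.

Let Y_lim : exists Z : V -> V, forall x n, nr (Z x - Y n x) <= nr x * e n.
Proof.
suff /choice[Z ZP] : forall x, exists z, forall n, nr (z - Y n x) <= nr x * e n.
  by exists Z.
move=> x.
apply: complete_rate => [|m n mn].
  by rewrite -(mulr0 (nr x)); apply: cvgM => //; exact: cvg_cst.
apply: le_trans (Y_diff x mn) _; rewrite mulrC ler_wpM2l ?nr_ge0//.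
by rewrite lerD2r; apply: nondecreasing_cvgn_le.
Qed.

Let Y_sym n x z : rip (Y n x) z = rip x (Y n z).
Proof.
elim: n x z => [|n ih] x z /=; first by rewrite /rip linear0l linear0r.
by rewrite ripZl ripZr !ripE -!ih /rip -B_sym.
Qed.

(* The square root is [1 - Y], where [Y] solves [Y = (B + Y^2) / 2]. The fixed
   point iteration started at 0 converges because its increments are bounded by
   those of the scalar iteration with [B] replaced by 1. *)
Lemma sqrt_contraction_exists : exists2 W : V -> V,
  positive_op W & forall x, W (W x) = x - B x.
Proof.
have [Z ZY] := Y_lim.
(* Each property passes from [Y n] to [Z] because its failure for [Z] is bounded by a constant times
   [e n], which tends to 0. *)
have nrZx x : nr (Z x) <= nr x.
  rewrite -subr_le0; apply: (le_vanishing (c := nr x) e0) => n.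
  have := ZY x n; have := nrD (Z x - Y n x) (Y n x); rewrite subrK.
  have := nrY n x; have := ler_wpM2r (nr_ge0 x) (majorant_le1 n); lra.
have lZ : linear Z.
  move=> a x z; apply/eqP; rewrite -subr_eq0; apply/eqP.
  apply: (nr_vanishing (c := nr (a *: x + z) + nr (a *: x) + nr z) e0) => n.
  have -> : Z (a *: x + z) - (a *: Z x + Z z) =
      (Z (a *: x + z) - Y n (a *: x + z)) + - (a *: (Z x - Y n x)) +
      - (Z z - Y n z).
    by rewrite linY scalerBr !opprB -addrA (addrACA (_ *: _)) -opprD addrA subrK.
  apply: le_trans (nrD _ _) _; rewrite mulrDl lerD//; last by rewrite nrN ZY.
  apply: le_trans (nrD _ _) _; rewrite mulrDl lerD ?ZY//.
  by rewrite nrN !nrZC -mulrA ler_wpM2l ?ZY// -lecR RRe_real ?ger0_real ?normr_ge0.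
have symZ x z : rip (Z x) z = rip x (Z z).
  apply/eqP; rewrite -subr_eq0 -normr_eq0 eq_le normr_ge0 andbT.
  apply: (le_vanishing (c := 2 * nr x * nr z) e0) => n.
  have -> : rip (Z x) z - rip x (Z z) = rip (Z x - Y n x) z - rip x (Z z - Y n z).
    by rewrite !ripE Y_sym; ring.
  apply: le_trans (ler_normB _ _) _.
  have := rip_abs_le (Z x - Y n x) z; have := rip_abs_le x (Z z - Y n z).
  have := ler_wpM2r (nr_ge0 z) (ZY x n); have := ler_wpM2l (nr_ge0 x) (ZY z n).
  lra.
have fixZ x : Z x = half *: (B x + Z (Z x)).
  apply/eqP; rewrite -subr_eq0; apply/eqP.
  apply: (nr_vanishing (c := 2 * nr x + nr (Z x)) e0) => n.
  (* The recursion for [Y n.+1] is subtracted, and [Y n (Y n x) - Z (Z x)] is split by inserting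
     [Y n (Z x)]. *)
  have -> : Z x - half *: (B x + Z (Z x)) = (Z x - Y n.+1 x) +
      half *: (Y n (Y n x - Z x) + - (Z (Z x) - Y n (Z x))).
    rewrite (linB (linY n)) opprB addrA subrK -addrA; congr (_ + _).
    rewrite [Y n.+1 x]/= -!scalerN -scalerDr; congr (_ *: _).
    by rewrite !opprD -addrA addKr.
  apply: le_trans (nrD _ _) _; rewrite nr_half.
  have := nrD (Y n (Y n x - Z x)) (- (Z (Z x) - Y n (Z x))); rewrite nrN.
  have := ler_wpM2l (nr_ge0 x) (_ : e n.+1 <= e n).
  rewrite lerD2l lerN2 majorant_nd// => /(_ isT).
  have YZ : nr (Y n x - Z x) <= nr x * e n by rewrite -nrN opprB ZY.
  have := ler_wpM2r (nr_ge0 (Y n x - Z x)) (majorant_le1 n).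
  have := nrY n (Y n x - Z x); have := ZY x n.+1; have := ZY (Z x) n.
  have := nr_ge0 (Z (Z x) - Y n (Z x)).
  have := nr_ge0 (Y n x - Z x); lra.
have linW := linear_idB lZ.
exists (fun x => x - Z x) => [|x].
  apply: selfadjoint_positive => [||x].
  - apply/bounded_opP; split=> //; exists 2 => // x.
    by have := nrD x (- Z x); rewrite nrN; have := nrZx x; lra.
  - by apply: is_adjoint_rip => // x z; rewrite !ripE symZ.
  - rewrite !ripE ripxx; have := rip_le (Z x) x.
    by have := ler_wpM2r (nr_ge0 x) (nrZx x); rewrite -expr2; lra.
have fixZ2 : Z x + Z x = B x + Z (Z x).
  by rewrite {1 2}fixZ -scalerDl halfD scale1r.
rewrite (linB lZ) opprB (addrC (Z (Z x))) addrA -(addrA x) -opprD fixZ2.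
by rewrite opprD addrA subrK.
Qed.

End SquareRoot.

(** * Spectra contained in {0, 1} *)

Section Spectrum.
Variables (R : realType) (V : hilbertType R).
Implicit Types T W : V -> V.

Lemma projection_spectrum W :
  orthogonal_projection W -> spectrum W `<=` [set 0; 1].
Proof.
move=> [bW WW _] z; apply: contra_notP => /= /not_orP[/eqP z0 /eqP z1].
have [lW [K K0 WK]] := (bounded_opP W).1 bW.
have {}WW x : W (W x) = W x by rewrite -[LHS]/((W \o W) x) WW.
have z1' : 1 - z != 0 by rewrite subr_eq0 eq_sym.
(* [W - z] acts as [1 - z] on the range of [W] and as [- z] on its kernel; [S] inverts it on both
   pieces. *)
pose S x := (1 - z)^-1 *: W x + (- z^-1) *: (x - W x).
have lS : linear S.
  by apply: linear_add; apply: linear_scale => //; exact: linear_idB.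
have WS x : W (S x) = S (W x).
  by rewrite /S (linD lW) !(linZ lW) (linB lW) WW.
have SW x : S (W x - z *: x) = x.
  rewrite /S (linB lW) (linZ lW) WW -[X in X - _ *: _]scale1r -scalerBl.
  have -> : W x - z *: x - (1 - z) *: W x = - z *: (x - W x).
    by rewrite scalerBl scale1r opprB [LHS]addrC addrA subrK scaleNr scalerBr opprB.
  by rewrite !scalerA mulVf// mulrNN mulVf// !scale1r addrC subrK.
exists S; split=> // [|x]; last by rewrite WS -(linZ lS) -(linB lS).
apply/bounded_opP; split=> //.
have Re_ge0 (a : R[i]) : 0 <= complex.Re `|a|.
  by rewrite -lecR RRe_real ?ger0_real ?normr_ge0.
exists (complex.Re `|(1 - z)^-1| * K + complex.Re `|z^-1| * (1 + K)).
  by rewrite addr_ge0 ?mulr_ge0 ?addr_ge0.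
move=> x; apply: le_trans (nrD _ _) _; rewrite !nrZC normrN mulrDl.
rewrite -!mulrA lerD ?ler_wpM2l// mulrDl mul1r.
by apply: le_trans (nrD _ _) _; rewrite nrN lerD2l.
Qed.

(** The consequence of having a bounded inverse that passes to products of factors [W - a]. *)
Definition bounded_below T :=
  exists2 K : R, 0 <= K & forall x, nr x <= K * nr (T x).

Lemma bounded_below_comp S T : bounded_below S -> bounded_below T ->
  bounded_below (S \o T).
Proof.
move=> [K K0 SK] [L L0 TL]; exists (L * K); first exact: mulr_ge0.
by move=> x; apply: le_trans (TL x) _; rewrite -mulrA ler_wpM2l.
Qed.

Lemma not_spectrum_bounded_below W z : ~ spectrum W z ->
  bounded_below (fun x => W x - z *: x).
Proof.
move=> /contrapT[S [/bounded_opP[_ [K K0 SK]] SW _]]; exists K => // x.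
by rewrite -[leLHS](congr1 (@nr _ _) (SW x)).
Qed.

(** With [a], [b] the roots of [t^2 - t + c], the operator is [- (W - a) (W - b)]. As [a b = c] is
    nonzero and [a + b = 1], neither root is 0 or 1. *)
Lemma spectrum01_quadratic W c : linear W -> spectrum W `<=` [set 0; 1] ->
  c != 0 -> bounded_below (fun x => W x - W (W x) - c *: x).
Proof.
move=> lW W01 c0.
pose d : R[i] := sqrtC (1 - 4 * c).
pose a := (1 + d) / 2; pose b := (1 - d) / 2.
have ab1 : a + b = 1 by rewrite /a /b; field.
have abc : a * b = c.
  have -> : a * b = (1 - d ^+ 2) / 4 by rewrite /a /b; field.
  by rewrite sqrtCK; field.
have a0 : a != 0 by apply: contra_neq c0 => a0; rewrite -abc a0 mul0r.
have b0 : b != 0 by apply: contra_neq c0 => b0; rewrite -abc b0 mulr0.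
have below e f : e != 0 -> f != 0 -> e + f = 1 -> bounded_below (fun x => W x - e *: x).
  move=> e0 f0 ef; apply: not_spectrum_bounded_below => /W01[] /= ez.
    by rewrite ez eqxx in e0.
  by move: f0; rewrite -[f](addKr e) ef ez addNr eqxx.
have [K K0 H] := bounded_below_comp (below _ _ a0 b0 ab1)
  (below _ _ b0 a0 (etrans (addrC b a) ab1)).
exists K => // x; rewrite -[X in _ * X]nrN; apply: le_trans (H x) _ => /=.
rewrite (_ : _ - a *: _ = - (W x - W (W x) - c *: x))//.
rewrite (linB lW) (linZ lW) scalerBr scalerA abc !opprB.
have {5}-> : W x = b *: W x + a *: W x by rewrite -scalerDl addrC ab1 scale1r.
by rewrite addrA addrAC [LHS]addrC opprD (addrA (W _)).
Qed.

(* For [A = W - W^2] and [M = |A|^2], the operator [A^2 - M] is not bounded below,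
   whereas it is a product of four factors [W - a] with [a] distinct from 0 and 1
   if [M <> 0]. *)
Lemma spectrum01_idempotent W : bounded_op W -> is_adjoint W W ->
  spectrum W `<=` [set 0; 1] -> forall x, W (W x) = W x.
Proof.
move=> /bounded_opP[lW [L L0 WL]] aW W01 x0.
pose A x := W x - W (W x).
suff : A x0 = 0 by move/eqP; rewrite subr_eq0 => /eqP.
have lA : linear A.
  by move=> a x y; rewrite /A !lW scalerBr opprD addrACA.
have symA x y : rip (A x) y = rip x (A y).
  by rewrite !ripE /rip !aW.
pose C := L + L ^+ 2.
have AC x : nr (A x) <= C * nr x.
  apply: le_trans (nrD _ _) _; rewrite nrN mulrDl lerD// expr2 -mulrA.
  by apply: le_trans (WL _) _; rewrite ler_wpM2l.
have C0 : 0 <= C by rewrite addr_ge0 ?exprn_ge0.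
pose E := [set nr (A x) ^+ 2 | x in [set x | nr x <= 1]].
have ubE : has_ubound E.
  exists (C ^+ 2) => _ [x /= x1 <-]; rewrite ler_sqr ?nnegrE ?nr_ge0//.
  by apply: le_trans (AC x) _; rewrite ler_piMr.
have E0 : E 0 by exists 0; rewrite /= ?nr0 // (lin0 lA) nr0 expr0n.
pose M := sup E.
have M0 : 0 <= M by apply: ub_le_sup.
have AM x : nr (A x) ^+ 2 <= M * nr x ^+ 2.
  have [/nr_eq0 ->|x_neq0] := eqVneq (nr x) 0.
    by rewrite (lin0 lA) nr0 expr0n mulr0.
  have xp : 0 < nr x by rewrite lt_neqAle eq_sym x_neq0 nr_ge0.
  rewrite -ler_pdivrMr ?exprn_gt0//; apply: ub_le_sup => //.
  exists ((nr x)^-1%:C *: x) => /=; rewrite ?(linZ lA) nrZ gtr0_norm ?invr_gt0//.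
    by rewrite mulVf.
  by rewrite exprMn exprVn mulrC.
have [Mz|Mnz] := eqVneq M 0.
  apply/nr_eq0/eqP; rewrite -sqrf_eq0 eq_le sqr_ge0 andbT.
  by have := AM x0; rewrite Mz mul0r.
have Mp : 0 < M by rewrite lt_neqAle eq_sym Mnz.
pose s := Num.sqrt M.
have ss : s ^+ 2 = M by rewrite sqr_sqrtr.
have sp : s%:C != 0 :> R[i] by rewrite (inj_eq (@complexI R)) sqrtr_eq0 -ltNge.
have sn : - s%:C != 0 :> R[i] by rewrite oppr_eq0.
(* [A^2 - M = (A - s) (A + s)], and each factor is a quadratic in [W] with nonzero constant term. *)
have [K K0 H] := bounded_below_comp (spectrum01_quadratic lW W01 sp)
  (spectrum01_quadratic lW W01 sn).
have {}H x : nr x <= K * nr (A (A x) - M%:C *: x).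
  apply: le_trans (H x) _ => /=; rewrite -/(A x) scaleNr opprK.
  rewrite -[W (A x + _) - _]/(A (A x + s%:C *: x)) (linD lA) (linZ lA) (scalerDr _ (A x)).
  rewrite opprD addrA addrK.
  by rewrite scalerA -rmorphM -expr2 ss.
(* Expanding [|A^2 x - M x|^2] and bounding [|A (A x)|^2] by [M |A x|^2] leaves
   [M (M |x|^2 - |A x|^2)]. *)
have HM x : nr x ^+ 2 <= K ^+ 2 * M * (M * nr x ^+ 2 - nr (A x) ^+ 2).
  have := H x; rewrite -ler_sqr ?nnegrE ?nr_ge0 ?mulr_ge0 ?nr_ge0//.
  rewrite exprMn nr_sqD nrN nrZ ger0_norm// exprMn ripNr ripZr symA ripxx.
  move=> /le_trans; apply; rewrite -mulrA ler_wpM2l ?exprn_ge0//.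
  by have := AM (A x); lra.
have Kp : 0 < K.
  rewrite lt_neqAle K0 andbT eq_sym; apply: contra_neq Mnz => Kz.
  have : forall x : V, x = 0.
    move=> x; apply/nr_eq0/eqP; rewrite eq_le nr_ge0 andbT.
    by have := H x; rewrite Kz mul0r.
  move=> all0; apply/eqP; rewrite eq_le M0 andbT; apply: ge_sup; first by exists 0.
  by move=> _ [x _ <-]; rewrite (all0 (A x)) nr0 expr0n.
(* [HM] divided by [K ^+ 2 * M] improves the bound [M] to [M - c], against the choice of [M] as a
   supremum. The maximum with 0 below covers a negative [M - c]. *)
pose c := (K ^+ 2 * M)^-1.
have cp : 0 < c by rewrite invr_gt0 mulr_gt0 ?exprn_gt0.
have AMc x : nr (A x) ^+ 2 <= (M - c) * nr x ^+ 2.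
  have := ler_wpM2l (ltW cp) (HM x); rewrite {2}/c mulKf; last by rewrite gt_eqF ?mulr_gt0 ?exprn_gt0.
  lra.
have : M <= Num.max 0 (M - c).
  apply: ge_sup; first by exists 0.
  move=> _ [x /= x1 <-]; apply: le_trans (AMc x) _.
  rewrite le_max; case: (leP (M - c) 0) => Mc.
    by rewrite mulr_le0_ge0 ?sqr_ge0.
  by rewrite ler_piMr ?orbT ?expr_le1 ?nr_ge0 ?(ltW Mc).
by move=> Mmax; exfalso; move: Mmax; rewrite le_max => /orP[|]; lra.
Qed.

End Spectrum.

(** * Defect operators *)

Section DefectOperators.
Variable R : realType.
Implicit Types U V : hilbertType R.

(** The composite [adjoint J \o J] is a selfadjoint contraction, so a positive square root exists
    and [sqrt_op] does not return its default value. *)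
Lemma defectP U V (J : U -> V) : contraction_op J ->
  positive_op (defect J) /\
  forall x, defect J (defect J x) = x - adjoint J (J x).
Proof.
move=> cJ; have aJ := adjointP (contraction_bounded cJ).
have /contraction_opP[lS S1] := contraction_adjoint cJ aJ.
have /contraction_opP[lJ J1] := cJ.
have [|x y|W W0 WW] := @sqrt_contraction_exists R U (adjoint J \o J).
- apply/contraction_opP; split=> [|x /=]; first exact: lin_comp.
  by apply: le_trans (S1 _) (J1 x).
- by rewrite /= -aJ (is_adjointC aJ).
rewrite /defect /sqrt_op; set A := [set _ | _].
have : exists W, A W by exists W; split=> //; apply/funext => x; exact: WW.
move=> /(xgetPex (cst 0))[pW eW]; split=> // x.
by rewrite -[LHS]/((_ \o _) x) eW.
Qed.

(** The adjoint of [adjoint J] is [J]; facts about defects thereby become facts about codefects. *)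
Lemma codefectE U V (J : U -> V) : contraction_op J ->
  codefect J = defect (adjoint J).
Proof.
move=> cJ; have aJ := adjointP (contraction_bounded cJ).
by rewrite /codefect /defect (adjointE (is_adjointC aJ)).
Qed.

Section Contraction.
(** [S] is a variable instead of [adjoint J] so that the results apply to a pair [J], [S] in either
    order. *)
Variables (U V : hilbertType R) (J : U -> V) (S : V -> U).
Hypotheses (cJ : contraction_op J) (JS : is_adjoint J S).
Local Notation W := (defect J).

Let SE : adjoint J = S. Proof. exact: adjointE. Qed.
Let lJ : linear J. Proof. by case: cJ. Qed.
Let lS : linear S. Proof. exact: is_adjoint_linear JS. Qed.
Let pW : positive_op W. Proof. by case: (defectP cJ). Qed.
Let WW x : W (W x) = x - S (J x). Proof. by case: (defectP cJ) => _ ->; rewrite SE. Qed.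
Let bW : bounded_op W. Proof. by case: pW. Qed.
Let lW : linear W. Proof. by case: bW. Qed.
Let aW : is_adjoint W W. Proof. exact: positive_selfadjoint. Qed.

Lemma defect_pythagoras x : nr (J x) ^+ 2 + nr (W x) ^+ 2 = nr x ^+ 2.
Proof.
rewrite -[X in _ + X]ripxx /rip aW WW -!/(rip _ _) ripDr ripNr -!ripxx.
by rewrite {3}/rip -JS -/(rip _ _); ring.
Qed.

Lemma defect_eq0 x : nr (W x) = 0 -> S (J x) = x.
Proof.
move=> /nr_eq0 Wx; apply/eqP; rewrite eq_sym -subr_eq0 -WW Wx.
by rewrite (lin0 lW).
Qed.

(** The range of [S] is orthogonal to the kernel of [J], so [J] is isometric on it. By Pythagoras
    [W] vanishes there, hence [S J S = S]; then take adjoints. *)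
Lemma partial_isometry_JSJ : partial_isometry J -> forall x, J (S (J x)) = J x.
Proof.
move=> [_ Jiso] x; have SJS y : S (J (S y)) = S y.
  have : orthocomplement (kernel_op J) (S y).
    by move=> k Jk; rewrite (is_adjointC JS) Jk linear0r.
  move=> /Jiso JSy; apply: defect_eq0.
  apply/eqP; rewrite -sqrf_eq0; apply/eqP.
  have := defect_pythagoras (S y); rewrite {1}/nr JSy -/(nr _); lra.
apply: inner_ext => y.
by rewrite -(is_adjointC JS) -JS -(is_adjointC JS) SJS (is_adjointC JS).
Qed.

(** For [x] orthogonal to the kernel of [J], the vector [x - S (J x)] lies both in that kernel and
    in its orthocomplement, so [S (J x) = x] and [|J x|^2 = <x, S (J x)> = |x|^2]. *)
Lemma JSJ_partial_isometry : (forall x, J (S (J x)) = J x) -> partial_isometry J.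
Proof.
move=> JSJ; split=> [|x xker]; first exact: contraction_bounded.
have SJx : S (J x) = x.
  have ker : kernel_op J (x - S (J x)) by rewrite /kernel_op/= (linB lJ) JSJ subrr.
  have /= := xker _ ker => ox; apply/eqP; rewrite eq_sym -subr_eq0; apply/eqP.
  apply/nr_eq0/eqP; rewrite -sqrf_eq0 -ripxx ripDl ripNl.
  by rewrite /rip ox (is_adjointC JS) ker linear0r/= subrr.
apply/eqP; rewrite -!nrE; apply/eqP; congr (_%:C).
apply/eqP; rewrite -(eqrXn2 (ltn0Sn 1)) ?nr_ge0//.
by rewrite -!ripxx {1}/rip JS SJx.
Qed.

Lemma JSJ_adjoint : (forall x, J (S (J x)) = J x) -> forall y, S (J (S y)) = S y.
Proof. by move=> JSJ y; apply: inner_ext => x; rewrite -JS -(is_adjointC JS) -JS JSJ JS. Qed.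

(* [W^2 = 1 - S J] is idempotent, whence [W^3 = W] as [W] is selfadjoint; then
   [W y = - y] for [y = W x - W^2 x], and [y = 0] by positivity of [W]. *)
Lemma JSJ_defect_projection :
  (forall x, J (S (J x)) = J x) -> orthogonal_projection W.
Proof.
move=> JSJ; split=> //; apply/funext => x /=.
have W4 z : W (W (W (W z))) = W (W z).
  by rewrite (WW (W (W z))) WW (linB lJ) JSJ subrr (lin0 lS) subr0.
have W3 z : W (W (W z)) = W z.
  apply/eqP; rewrite -subr_eq0; apply/eqP/nr_eq0/eqP.
  rewrite -sqrf_eq0 -ripxx !ripE /rip !aW !W4.
  by apply/eqP; ring.
pose y := W x - W (W x).
have Wy : W y = - y by rewrite /y (linB lW) W3 opprB.
have : y = 0.
  apply/nr_eq0/eqP; rewrite -sqrf_eq0 eq_le sqr_ge0 andbT -ripxx.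
  rewrite -oppr_ge0 -ripNl -Wy.
  by case: pW => _ /(_ y); rewrite lecE => /andP[].
by move/eqP; rewrite subr_eq0 eq_sym => /eqP.
Qed.

Lemma spectrum01_JW : spectrum W `<=` [set 0; 1] -> J \o W = cst 0.
Proof.
move=> /(spectrum01_idempotent bW aW) WWW; apply/funext => x /=.
apply/nr_eq0/eqP; rewrite -sqrf_eq0; apply/eqP.
(* [W] is idempotent, so Pythagoras at [W x] leaves nothing for [J (W x)]. *)
by have := defect_pythagoras (W x); rewrite WWW; lra.
Qed.

Lemma JW_JSJ : J \o W = cst 0 -> forall x, J (S (J x)) = J x.
Proof.
move=> JW x; apply/eqP; rewrite eq_sym -subr_eq0 -(linB lJ) -WW.
by rewrite -[J _]/((J \o W) (W x)) JW.
Qed.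

Lemma JW_WS : J \o W = cst 0 <-> W \o S = cst 0.
Proof.
split=> e; apply/funext => x /=; apply: inner_ext => y.
  by rewrite -aW -JS -[J _]/((J \o W) y) e !linear0r linear0l.
by rewrite -(is_adjointC JS) -aW -[W _]/((W \o S) y) e !linear0r linear0l.
Qed.

Lemma range_defect_projection :
  orthogonal_projection W -> range W = kernel_op J.
Proof.
move=> [_ WWW _]; apply/seteqP; split=> [_ [x _ <-]|x /= Jx].
  apply/nr_eq0/eqP; rewrite -sqrf_eq0; apply/eqP.
  have := defect_pythagoras (W x).
  by rewrite -[W (W x)]/((W \o W) x) WWW; lra.
by exists (W x) => //; rewrite WW Jx (lin0 lS) subr0.
Qed.

End Contraction.
End DefectOperators.

(** * The parent space *)

Section Parent.
Variables (R : realType) (Hinf : hilbertType R) (H : nat -> hilbertType R).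
Variable J : forall k, H k -> Hinf.
Arguments J : clear implicits.
Local Notation E := (parent_component Hinf H).

(** The embeddings into the parent space have finitely supported values, so their adjoints can be
    read off from finite sums. *)
Lemma l2inner_finite (F : nat -> hilbertType R) N (f g : l2sum F) :
  (forall k, (N <= k)%N -> f k = 0) ->
  l2inner f g = \sum_(0 <= k < N) inner (f k) (g k).
Proof.
move=> f0; apply: (@cvg_lim R[i]^o (@norm_hausdorff _ R[i]^o)).
apply: cvg_near_cst; exists N => // m /= Nm.
rewrite /series/= (big_cat_nat (leq0n N) Nm)/= [X in _ + X]big1_seq ?addr0// => k.
by rewrite mem_index_iota => /andP[_ /andP[Nk _]]; rewrite f0// linear0l.
Qed.

Lemma parent_iota_inf_adjoint :
  adjoint (parent_iota_inf H) = (fun f : parent Hinf H => (f : l2sum E) 0%N : Hinf).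
Proof.
apply: adjointE => x f.
by rewrite -[LHS]/(l2inner _ _) (@l2inner_finite _ 1) ?big_nat1// => -[].
Qed.

Lemma parent_iota_adjoint n : contraction_op (J n) ->
  adjoint (@parent_iota R Hinf H J n) =
  fun f : parent Hinf H => adjoint (J n) ((f : l2sum E) 0%N) +
                           defect (J n) ((f : l2sum E) n.+1).
Proof.
move=> cJ; have [pW _] := defectP cJ; apply: adjointE => x f.
rewrite -[LHS]/(l2inner _ _) (@l2inner_finite _ n.+2) => [|[//|j] nj]; last first.
  by rewrite /= dfwith_out// ltn_eqF.
(* Only component 0 (index infinity) and component [n.+1] (the space [H n]) contribute, namely the
   first and last of the [n.+2] terms. *)
rewrite big_nat_recl// big_nat_recr//= dfwith_in big1_seq ?add0r.
  rewrite linearDr/= -(positive_selfadjoint pW).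
  by rewrite (adjointP (contraction_bounded cJ)).
move=> k; rewrite mem_index_iota => /andP[_ /andP[_ kn]].
by rewrite dfwith_out ?linear0l// gtn_eqF.
Qed.

Lemma parent_proj_comm n : contraction_op (J n) ->
  parent_proj J n \o parent_proj_inf H = parent_proj_inf H \o parent_proj J n
  <-> J n \o defect (J n) = cst 0.
Proof.
move=> cJ; rewrite /parent_proj /parent_proj_inf parent_iota_inf_adjoint.
rewrite parent_iota_adjoint//.
have aJ := adjointP (contraction_bounded cJ).
have [[[lW _] _] _] := defectP cJ; have lJ := cJ.1.
split=> [comm|JW]; apply/funext => x /=.
  (* Test vector supported on the component [H n]: at component 0 the first product gives 0 and the
     second gives [J n (defect (J n) x)]. *)
  have sx : square_summable (dfwith (fun k => 0 : E k) (i := n.+1) x).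
    by apply: (finite_square_summable n.+2) => k nk; rewrite dfwith_out// ltn_eqF.
  have := congr1 (fun F => (F (L2Sum sx) : l2sum E) 0%N) comm.
  rewrite /= dfwith_out// dfwith_in (lin0 (is_adjoint_linear aJ)) (lin0 lW).
  by rewrite addr0 add0r (lin0 lJ).
have /(JW_WS cJ aJ) WS := JW.
(* Component 0 needs [J W = 0], component [n.+1] needs [W S = 0], and both products vanish in the
   others. *)
apply: l2sum_eq => -[|j] /=.
  by rewrite (lin0 lW) addr0 (linD lJ) -[J n (defect _ _)]/((J n \o _) _) JW addr0.
case: dfwithP => //.
by rewrite (lin0 lW) addr0 -[LHS]/((_ \o adjoint (J n)) _) WS.
Qed.

End Parent.

(** * The cycle of implications *)

Unset Implicit Arguments.

Theorem theorem3p9 (R : realType) (Hinf : hilbertType R)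
    (H : nat -> hilbertType R) (J : forall k, H k -> Hinf)
    (sep_inf : separable_space Hinf) (sep : forall k, separable_space (H k))
    (J_contr : forall k, contraction_op (J k)) (n : nat) :
  [<-> partial_isometry (J n);
       orthogonal_projection (defect (J n));
       spectrum (defect (J n)) `<=` [set 0; 1];
       J n \o defect (J n) = cst 0;
       partial_isometry (adjoint (J n));
       orthogonal_projection (codefect (J n));
       spectrum (codefect (J n)) `<=` [set 0; 1];
       codefect (J n) \o J n = cst 0;
       parent_proj J n \o parent_proj_inf H =
         parent_proj_inf H \o parent_proj J n]
  /\ (orthogonal_projection (defect (J n)) ->
        range (defect (J n)) = kernel_op (J n))
  /\ (orthogonal_projection (codefect (J n)) ->
        range (codefect (J n)) = kernel_op (adjoint (J n))).
Proof.
have cJ := J_contr n; have JS := adjointP (contraction_bounded cJ).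
have SJ := is_adjointC JS; have cS := contraction_adjoint cJ JS.
rewrite (codefectE cJ); split; last first.
  by split; [exact: range_defect_projection JS|exact: range_defect_projection SJ].
tfae.
- by move=> /(partial_isometry_JSJ cJ JS); exact: JSJ_defect_projection JS.
- exact: projection_spectrum.
- exact: spectrum01_JW JS.
- by move=> /(JW_JSJ cJ JS)/(JSJ_adjoint JS); exact: JSJ_partial_isometry SJ.
- by move=> /(partial_isometry_JSJ cS SJ); exact: JSJ_defect_projection SJ.
- exact: projection_spectrum.
- by move=> /(spectrum01_JW cS SJ)/(JW_WS cS SJ).
(* Commutation is tied to assertion (4), so (8) is first carried back to [J S J = J] and from there
   through (2) and (3) to (4). *)
- move=> /(JW_WS cS SJ)/(JW_JSJ cS SJ)/(JSJ_adjoint SJ).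
  move=> /(JSJ_defect_projection cJ JS)/projection_spectrum/(spectrum01_JW cJ JS).
  by move/(parent_proj_comm cJ).
- by move=> /(parent_proj_comm cJ)/(JW_JSJ cJ JS); exact: JSJ_partial_isometry JS.
Qed.
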